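(* Let $\{v_n\}_{n\ge 1}$ be a convex sequence of real numbers with $\lim_{n\to\infty} v_n=0$. Let $V$ be the self-adjoint Toeplitz matrix defined by $V_{ii}=0$ and $V_{ij}=v_{|i-j|}$ for $i\ne j$. Then for every $N\ge 1$ and every $\mathbf{u}\in\mathbb{C}^N$ (with $V$ acting through its upper-left $N\times N$ principal block, i.e. identifying $\mathbf{u}$ with a finitely supported sequence), $$\langle V\mathbf{u},\mathbf{u}\rangle \;\ge\; (v_2-2v_1)\,\|\mathbf{u}\|^2 .$$
   Context: A real sequence $\{v_n\}_{n\ge 1}$ is convex if $v_{n-1}-2v_n+v_{n+1}\ge 0$ for every $n\ge 2$. Here $\langle V\mathbf{u},\mathbf{u}\rangle=\sum_{i,j}V_{ij}u_j\overline{u_i}$ and $\|\mathbf{u}\|$ is the $\ell^2$ (Euclidean) norm. *)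

(* Defs.v *)
(* MathComp / MathComp-Analysis *)
From HB Require Import structures.
From mathcomp Require Import all_boot all_order all_algebra.
From mathcomp Require Import all_classical all_reals all_analysis.
From mathcomp Require Export complex.

Set Implicit Arguments.
Unset Strict Implicit.
Unset Printing Implicit Defensive.

Import Order.TTheory GRing.Theory Num.Theory.

Local Open Scope ring_scope.

(* A sequence {v_n}_{n >= 1} is a function v : nat -> R whose value at 0 is
   never used. *)
Definition convex_seq (R : realType) (v : nat -> R) : Prop :=
  forall n : nat, (2 <= n)%N -> 0 <= v n.-1 - 2 * v n + v n.+1.

(* Infinite matrix; as the entries depend only on i - j, it does not matter
   whether rows and columns are numbered from 0 or from 1. *)
Definition toeplitz (R : realType) (v : nat -> R) (i j : nat) : R :=
  if i == j then 0 else v `|i%:Z - j%:Z|%N.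

Definition principal_block (R : realType) (A : nat -> nat -> R) (N : nat) :
    'M[R[i]]_N :=
  \matrix_(i < N, j < N) real_complex R (A i j).

(* <A u, u>, conjugate-linear in the second argument *)
Definition quad_form (C : numClosedFieldType) (N : nat)
    (A : 'M[C]_N) (u : 'cV[C]_N) : C :=
  \sum_(i < N) \sum_(j < N) A i j * u j 0 * (u i 0)^*.

Definition l2norm (C : numClosedFieldType) (N : nat) (u : 'cV[C]_N) : C :=
  sqrtC (\sum_(i < N) `|u i 0| ^+ 2).

(* Main.v *)
Require Import Defs.
From HB Require Import structures.
From mathcomp Require Import all_boot all_order all_algebra.
From mathcomp Require Import all_classical all_reals all_analysis.
From mathcomp Require Import zify ring lra.
Import Order.TTheory GRing.Theory Num.Theory.
Import numFieldNormedType.Exports.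
Local Open Scope classical_set_scope.
Local Open Scope ring_scope.

(** Setting [w 0 = 2 v_1 - v_2] and [w n = v_n] for [n >= 1] extends [v] to a
    sequence that is convex, nonincreasing and nonnegative from index 0 on, and
    the claim says that its Toeplitz matrix is positive semidefinite.  Summing by
    parts twice, on the [N x N] block [w] is a nonnegative combination of the
    constant 1 and of the tent functions [n |-> max (m - n) 0].  The Toeplitz
    matrix of a tent is a Gram matrix: [max (m - |i - j|) 0] is the number of
    common points of the windows [[i, i + m)] and [[j, j + m)]. *)

Section QuadForm.
Variables (C : numClosedFieldType) (N : nat) (u : 'cV[C]_N).

Lemma quad_formD (A B : 'M[C]_N) :
  quad_form (A + B) u = quad_form A u + quad_form B u.
Proof.
rewrite /quad_form -big_split; apply: eq_bigr => i _.
by rewrite -big_split; apply: eq_bigr => j _; rewrite mxE !mulrDl.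
Qed.

Lemma quad_formZ (a : C) (A : 'M[C]_N) :
  quad_form (a *: A) u = a * quad_form A u.
Proof.
rewrite /quad_form mulr_sumr; apply: eq_bigr => i _.
by rewrite mulr_sumr; apply: eq_bigr => j _; rewrite mxE !mulrA.
Qed.

Lemma quad_form_sum_ge0 (K : nat) (A : 'I_K -> 'M[C]_N) :
  (forall k, 0 <= quad_form (A k) u) -> 0 <= quad_form (\sum_k A k) u.
Proof.
move=> A_ge0; apply: (big_ind (fun B => 0 <= quad_form B u)) => //.
  by rewrite -(scale0r (0 : 'M[C]_N)) quad_formZ mul0r.
by move=> A1 A2 A1_ge0 A2_ge0; rewrite quad_formD addr_ge0.
Qed.

Lemma quad_form1 : quad_form 1%:M u = l2norm u ^+ 2.
Proof.
rewrite /l2norm sqrtCK; apply: eq_bigr => i _.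
rewrite (bigD1 i) //= big1 => [|j /negPf jNi]; rewrite mxE.
  by rewrite eqxx mul1r addr0 normCK.
by rewrite eq_sym jNi !mul0r.
Qed.

(** The matrix has rank one, the indicator vector of [p] times its transpose, so its form is the
    squared modulus of the sum of [u] over [p]. *)
Lemma quad_form_indicator_ge0 (p : pred nat) :
  0 <= quad_form (\matrix_(i, j) (p i && p j)%:R) u.
Proof.
suff -> : quad_form (\matrix_(i, j) (p i && p j)%:R) u
    = `|\sum_(j < N) (p j)%:R * u j 0| ^+ 2 by rewrite exprn_ge0.
(* [mulrC] puts the conjugate factor first: the outer index [i] is the conjugated one. *)
rewrite normCK mulrC rmorph_sum mulr_suml; apply: eq_bigr => i _.
rewrite mulr_sumr; apply: eq_bigr => j _.
rewrite mxE -mulnb natrM rmorphM /= conjC_nat; ring.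
Qed.

End QuadForm.

Lemma sum_window_overlap (m n i j : nat) : (i < n)%N -> (j < n)%N ->
  (\sum_(t < n + m) ((i <= t < i + m) && (j <= t < j + m)))%N
    = (m - `|i%:Z - j%:Z|)%N.
Proof.
move=> ltin ltjn.
(* Two windows of length [m] meet in a single interval, and it ends before [n + m], so the range of
   [t] cuts nothing off. *)
have E (t : nat) : ((i <= t < i + m) && (j <= t < j + m))%N
   = (maxn i j <= t < minn i j + m)%N by lia.
under eq_bigr => t _ do rewrite E.
have count (a b K : nat) : (b <= K)%N -> (\sum_(t < K) (a <= t < b))%N = (b - a)%N.
  elim: K b => [|K IH] b leb; first by rewrite big_ord0; lia.
  rewrite big_ord_recr /=; case: (ltngtP b K.+1) leb => // [ltb|->] _.
    by rewrite IH; lia.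
  rewrite (eq_bigr (fun t : 'I_K => (a <= t < K)%N : nat)) => [|t _].
    by rewrite IH //; lia.
  by congr nat_of_bool; have := ltn_ord t; lia.
by rewrite count; lia.
Qed.

Lemma quad_form_tent_ge0 (C : numClosedFieldType) (N m : nat) (u : 'cV[C]_N) :
  0 <= quad_form (\matrix_(i, j) (m - `|i%:Z - j%:Z|)%:R) u.
Proof.
have -> : \matrix_(i, j) (m - `|(i : 'I_N)%:Z - (j : 'I_N)%:Z|)%:R
    = \sum_(t < N + m) \matrix_(i, j)
        ((i <= t < i + m)%N && (j <= t < j + m)%N)%:R :> 'M[C]_N.
  apply/matrixP => i j; rewrite summxE mxE -(sum_window_overlap m N) //.
  by rewrite natr_sum; apply: eq_bigr => t _; rewrite mxE.
by apply: quad_form_sum_ge0 => t;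
  exact: (quad_form_indicator_ge0 _ _ _ (fun i => i <= t < i + m)%N).
Qed.

(** Induction on [K]: for [n <= K] the tent grows by one, and the change in the boundary terms is
    the new second difference times [K.+1 - n]. For [n = K.+1] truncated subtraction kills every
    tent. *)
Lemma tent_decomposition (R : comPzRingType) (w : nat -> R) (K n : nat) :
  (n <= K)%N ->
  w n = w K + (w K - w K.+1) * (K - n)%:R
        + \sum_(m < K) (w m - 2 * w m.+1 + w m.+2) * (m.+1 - n)%:R.
Proof.
elim: K => [|K IH]; first by rewrite leqn0 => /eqP ->; rewrite big_ord0 subnn mulr0 !addr0.
rewrite leq_eqVlt => /predU1P[->|ltnK].
  rewrite subnn big1 ?mulr0 ?addr0 // => m _.
  have /eqP -> : (m.+1 - K.+1 == 0)%N by rewrite subn_eq0.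
  by rewrite mulr0.
rewrite {1}IH // big_ord_recr /= subSn // -natr1; ring.
Qed.

Section Convex.
Variables (R : realType) (v : nat -> R).
Hypotheses (v_convex : convex_seq v) (v_lim : v n @[n --> \oo] --> (0 : R)).

(** By convexity the drops [d] decrease, and they tend to 0, so none is negative. *)
Lemma convex_seq_to0_nonincreasing (n : nat) : v n.+2 <= v n.+1.
Proof.
pose d k := v k.+1 - v k.+2.
have d_noninc : nonincreasing_seq d.
  apply/nonincreasing_seqP => k; rewrite /d.
  by have := v_convex k.+2 isT => /=; lra.
have v1 : v n.+1 @[n --> \oo] --> (0 : R) by rewrite (cvg_shiftS v).
have v2 : v n.+2 @[n --> \oo] --> (0 : R) by rewrite (cvg_shiftS (fun k => v k.+1)).
have d_lim : d @ \oo --> (0 : R) by rewrite -(subr0 0); exact: cvgB v1 v2.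
have := nonincreasing_cvgn_ge d_noninc (cvgP _ d_lim) n.
by rewrite (cvg_lim _ d_lim) // /d; lra.
Qed.

Lemma convex_seq_to0_ge0 (n : nat) : 0 <= v n.+1.
Proof.
have v_noninc : nonincreasing_seq (fun k => v k.+1).
  by apply/nonincreasing_seqP => k; exact: convex_seq_to0_nonincreasing.
have v1 : v n.+1 @[n --> \oo] --> (0 : R) by rewrite (cvg_shiftS v).
have := nonincreasing_cvgn_ge v_noninc (cvgP _ v1) n.
by rewrite (cvg_lim _ v1).
Qed.

End Convex.

(** Distances in the block are at most [N], so the decomposition is cut at [K = N]; the two
    hypotheses at [N] give the signs of its boundary coefficients. *)
Lemma quad_form_convex_ge0 (R : realType) (w : nat -> R) (N : nat)
    (u : 'cV[R[i]]_N) :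
  (forall n, 0 <= w n - 2 * w n.+1 + w n.+2) -> w N.+1 <= w N -> 0 <= w N ->
  0 <= quad_form (\matrix_(i, j) real_complex R (w `|i%:Z - j%:Z|%N)) u.
Proof.
move=> w_convex w_noninc w_ge0.
have -> : \matrix_(i, j) real_complex R (w `|(i : 'I_N)%:Z - (j : 'I_N)%:Z|%N)
    = real_complex R (w N) *: \matrix_(i, j) (predT i && predT j)%:R
    + real_complex R (w N - w N.+1) *: \matrix_(i, j) (N - `|i%:Z - j%:Z|)%:R
    + \sum_(m < N) real_complex R (w m - 2 * w m.+1 + w m.+2)
        *: \matrix_(i, j) (m.+1 - `|i%:Z - j%:Z|)%:R.
  apply/matrixP => i j; rewrite !mxE summxE.
  have dist_le : (`|i%:Z - j%:Z| <= N)%N.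
    by have := ltn_ord i; have := ltn_ord j; lia.
  rewrite (tent_decomposition _ w N _ dist_le) !rmorphD rmorphM rmorph_nat.
  rewrite rmorph_sum mulr1 -rmorphD; congr (_ + _ + _).
  by apply: eq_bigr => m _; rewrite !mxE rmorphM rmorph_nat.
have ge0C (a : R) : 0 <= a -> 0 <= real_complex R a by rewrite lecR.
rewrite !quad_formD !quad_formZ !addr_ge0 ?mulr_ge0 ?quad_form_tent_ge0 //.
- exact: ge0C.
- exact: (quad_form_indicator_ge0 _ _ _ predT).
- by apply: ge0C; rewrite subr_ge0.
- apply: quad_form_sum_ge0 => m.
  by rewrite quad_formZ mulr_ge0 ?quad_form_tent_ge0 // ge0C.
Qed.

(* The order on R[i] is x <= y iff y - x is a nonnegative real. *)
Theorem theorem2 (R : realType) (v : nat -> R)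
  (v_convex : convex_seq v)
  (v_lim : v n @[n --> \oo] --> (0 : R))
  (N : nat) (N_ge1 : (1 <= N)%N) (u : 'cV[R[i]]_N) :
  real_complex R (v 2%N - 2 * v 1%N) * l2norm u ^+ 2
    <= quad_form (principal_block (toeplitz v) N) u.
Proof.
(* This value at 0 makes the second difference of [w] at 0 vanish. *)
pose w n := if n is 0%N then 2 * v 1%N - v 2%N else v n.
rewrite -quad_form1 -quad_formZ.
have -> : principal_block (toeplitz v) N
    = real_complex R (v 2%N - 2 * v 1%N) *: 1%:M
      + \matrix_(i, j) real_complex R (w `|i%:Z - j%:Z|%N).
  apply/matrixP => i j; rewrite !mxE /toeplitz -val_eqE /=.
  have [->|neq_ij] := eqVneq (i : nat) j.
    by rewrite subrr /= mulr1 -rmorphD; congr (real_complex R _); ring.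
  have dist_gt0 : (0 < `|i%:Z - j%:Z|)%N by lia.
  by rewrite mulr0 add0r; case: `|_|%N dist_gt0.
(* With [N] a successor, [w] at the cut reduces to [v]. *)
rewrite quad_formD lerDl; case: N N_ge1 u => // N _ u.
apply: quad_form_convex_ge0 => [[|n]||] /=.
- by lra.
- exact: (v_convex n.+2 isT).
- exact: convex_seq_to0_nonincreasing.
- exact: convex_seq_to0_ge0.
Qed.
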